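(* Let $p\ge 3$ and let $\Gamma$ be a random matrix having the Haar probability distribution on the group $\mathcal{O}_p$ of $p\times p$ real orthogonal matrices, with the null set where $\Gamma_{11}\in\{-1,1\}$ removed from its sample space. Partition $$\Gamma=\begin{pmatrix}\Gamma_{11}&\Gamma_{12}\\ \Gamma_{21}&\Gamma_{22}\end{pmatrix}$$ with $\Gamma_{11}$ of size $1\times 1$, $\Gamma_{12}$ of size $1\times(p-1)$, $\Gamma_{21}$ of size $(p-1)\times 1$ and $\Gamma_{22}$ of size $(p-1)\times(p-1)$. Let $\varepsilon_1=(1,0,\dots,0)'\in\mathbb{R}^{p-1}$. Fix the values of $\Gamma_{11}\in(-1,1)$, $\Gamma_{21}$ and $\Gamma_{12}$, and let $h_1,h_2\in\mathcal{O}_{p-1}$ (depending only on these values) satisfy $$h_1\varepsilon_1=\frac{1}{\sqrt{1-\Gamma_{11}^2}}\,\Gamma_{21},\qquad h_2\varepsilon_1=\frac{1}{\sqrt{1-\Gamma_{11}^2}}\,\Gamma_{12}'.$$ Let $\Delta$ be a $(p-2)\times(p-2)$ random matrix with the Haar distribution on $\mathcal{O}_{p-2}$. Then a version of the conditional distribution of $\Gamma_{22}$ given $(\Gamma_{21},\Gamma_{12},\Gamma_{11})$ is the distribution $$\mathcal{L}\left(h_1\begin{pmatrix}-\Gamma_{11}&0\\0&\Delta\end{pmatrix}h_2'\right),$$ where in this expression $\Gamma_{11},h_1,h_2$ are held fixed and only $\Delta$ is random.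
   Context: $\mathcal{L}(\cdot)$ denotes the distribution (probability law) of a random object. A prime denotes transpose. The Haar distribution on $\mathcal{O}_n$ (the $n\times n$ real orthogonal matrices) is the unique probability distribution with $\mathcal{L}(\Gamma)=\mathcal{L}(g_1\Gamma)=\mathcal{L}(\Gamma g_2)$ for all $g_1,g_2\in\mathcal{O}_n$. Note that orthogonality of $\Gamma$ forces $\|\Gamma_{21}\|^2=\|\Gamma_{12}\|^2=1-\Gamma_{11}^2$. *)

(* Defs.v *)
From HB Require Import structures.
From mathcomp Require Import all_boot all_order all_algebra.
From mathcomp Require Import all_classical all_reals all_analysis.

Set Implicit Arguments.
Unset Strict Implicit.
Unset Printing Implicit Defensive.

Import Order.TTheory GRing.Theory Num.Theory.

Local Open Scope classical_set_scope.
Local Open Scope ring_scope.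

Definition measure_matrix_display : measure_display -> measure_display.
Proof. exact. Qed.

(* Matrices carry the product sigma-algebra, i.e. the smallest one making      *)
(* every entry measurable; over a realType R it is the Borel sigma-algebra of  *)
(* 'M[R]_(m, n). *)
Definition g_sigma_entries d (T : measurableType d) (m n : nat) :
    set (set 'M[T]_(m, n)) :=
  <<s \bigcup_(ij in [set: 'I_m * 'I_n])
        preimage_set_system setT (fun M : 'M[T]_(m, n) => M ij.1 ij.2)
          measurable >>.

Section measurable_matrix.
Context d (T : measurableType d) (m n : nat).

Let matrix_set0 : @g_sigma_entries d T m n set0.
Proof. exact: sigma_algebra0. Qed.

Let matrix_setC A : @g_sigma_entries d T m n A -> g_sigma_entries (~` A).
Proof. exact: sigma_algebraC. Qed.

Let matrix_bigcup (F : _^nat) : (forall i, @g_sigma_entries d T m n (F i)) ->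
  g_sigma_entries (\bigcup_i (F i)).
Proof. exact: sigma_algebra_bigcup. Qed.

HB.instance Definition _ := @isMeasurable.Build (measure_matrix_display d)
  'M[T]_(m, n) (@g_sigma_entries d T m n) matrix_set0 matrix_setC matrix_bigcup.

End measurable_matrix.

Lemma measurable_entry d (T : measurableType d) m n (i : 'I_m) (j : 'I_n) :
  measurable_fun [set: 'M[T]_(m, n)] (fun M => M i j).
Proof.
move=> _ Y mY; rewrite setTI; apply: sub_sigma_algebra.
by exists (i, j) => //; exists Y => //; rewrite setTI.
Qed.

Lemma measurable_fun_mxP d d' (U : measurableType d') (T : measurableType d)
    m n (f : U -> 'M[T]_(m, n)) :
  measurable_fun [set: U] f <->
  forall i j, measurable_fun [set: U] (fun u => f u i j).
Proof.
split=> [mf i j|mf].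
  exact: (measurableT_comp (measurable_entry i j) mf).
move=> _ Y mY; rewrite setTI.
have : sigma_algebra setT [set B | measurable (f @^-1` B)].
  split.
  - by rewrite /= preimage_set0.
  - by move=> A /= mA; rewrite setTD preimage_setC; exact: measurableC.
  - by move=> F mF /=; rewrite preimage_bigcup; apply: bigcup_measurable => i _; exact: mF.
move=> sB; apply: (smallest_sub sB _ mY) => B [[i j] _ [C mC <-]] /=.
by rewrite setTI; have := mf i j measurableT C mC; rewrite setTI.
Qed.

Section haar.
Context (R : realType).

Definition orthogonalmx n (A : 'M[R]_n) : Prop :=
  A *m A^T = 1%:M /\ A^T *m A = 1%:M.

Definition is_haar n (mu : probability 'M[R]_n R) : Prop :=
  mu [set M | orthogonalmx M] = 1%E /\
  forall g, orthogonalmx g -> forall A, measurable A ->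
    mu [set M | A (g *m M)] = mu A /\ mu [set M | A (M *m g)] = mu A.

End haar.

(* k is a version of the conditional distribution of Y given X: it represents  *)
(* P (Y \in B | X) for all measurable B simultaneously. *)
Definition is_cond_distribution d d1 d2 (T : measurableType d)
    (U : measurableType d1) (V : measurableType d2) (R : realType)
    (P : probability T R) (Y : {RV P >-> V}) (X : {RV P >-> U})
    (k : R.-pker U ~> V) : Prop :=
  forall A B, measurable A -> measurable B ->
    P (X @^-1` A `&` Y @^-1` B) = (\int[distribution P X]_(x in A) k x B)%E.

Section blocks.
Context (R : realType) (m : nat).

Definition corner (G : 'M[R]_(1 + (1 + m))) : R := ulsubmx G 0 0.

(* (Gamma_21, Gamma_12, Gamma_11) for G partitioned as                         *)
(* block_mx Gamma_11 Gamma_12 Gamma_21 Gamma_22. *)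
Definition border (G : 'M[R]_(1 + (1 + m))) :
    'cV[R]_(1 + m) * 'rV[R]_(1 + m) * R :=
  (dlsubmx G, ursubmx G, corner G).

Definition orthogonal_nocorner : set 'M[R]_(1 + (1 + m)) :=
  [set G | orthogonalmx G /\ corner G != -1 /\ corner G != 1].

(* The conditioning values (Gamma_21, Gamma_12, Gamma_11) that occur on the    *)
(* orthogonal group once Gamma_11 = -1, 1 is excluded. *)
Definition border_values : set ('cV[R]_(1 + m) * 'rV[R]_(1 + m) * R) :=
  border @` orthogonal_nocorner.

Definition eps1 : 'cV[R]_(1 + m) := delta_mx ord0 ord0.

Lemma measurable_border : measurable_fun setT border.
Proof.
apply: measurable_fun_pair; first apply: measurable_fun_pair.
- apply/measurable_fun_mxP => i j.
  under [X in measurable_fun _ X]funext do rewrite !mxE.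
  exact: measurable_entry.
- apply/measurable_fun_mxP => i j.
  under [X in measurable_fun _ X]funext do rewrite !mxE.
  exact: measurable_entry.
- under [X in measurable_fun _ X]funext do rewrite /corner !mxE.
  exact: measurable_entry.
Qed.

Lemma measurable_drsubmx :
  measurable_fun setT (@drsubmx R 1 (1 + m) 1 (1 + m)).
Proof.
apply/measurable_fun_mxP => i j.
under [X in measurable_fun _ X]funext do rewrite !mxE.
exact: measurable_entry.
Qed.

HB.instance Definition _ :=
  @isMeasurableFun.Build _ _ _ _ border measurable_border.
HB.instance Definition _ := @isMeasurableFun.Build _ _ _ _
  (@drsubmx R 1 (1 + m) 1 (1 + m)) measurable_drsubmx.

End blocks.

(* Main.v *)
Require Import Defs.
From HB Require Import structures.
From mathcomp Require Import all_boot all_order all_algebra.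
From mathcomp Require Import all_classical all_reals all_analysis.
From mathcomp Require Import ring measurable_realfun.

Set Implicit Arguments.
Unset Strict Implicit.
Unset Printing Implicit Defensive.

Import Order.TTheory GRing.Theory Num.Theory.
Local Open Scope classical_set_scope.
Local Open Scope ring_scope.

(** Split G as block_mx a v u M, its first row and column being framed apart,
    and put s = sqrt (1 - a^2). When G is orthogonal, u and v have length s, and
    in orthonormal frames K, L whose first vectors are u / s and v^T / s the
    block M becomes diag(-a, C) with C orthogonal ([drsubmx_factor]). The
    theorem says that C is Haar distributed and independent of the border of G.

    Multiplying Gamma by a random matrix that depends on its own border need not
    preserve its law, so C cannot be randomized directly. Instead, randomize
    with an independent left-invariant H on the orthogonal group of size 1 + m:
    Gamma and Gamma * diag(1, H) have the same law. Now freeze Gamma = G. By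
    left invariance H may be replaced by g H for any orthogonal g, which may
    depend on G as H is independent of it; a suitable g turns the row
    v into s e1^T and M into K diag(-a, D), with D any prescribed orthogonal
    matrix ([orthogonal_nocorner_coset]). Averaging over a Haar
    distributed D and then freezing H, one sees D in the frames K and H^T, which
    are adapted to the border of G * diag(1, H). So, for each frozen G, drawing
    G * diag(1, H) gives the same law as drawing it and then resampling its
    inner block from the claimed conditional law ([average_resample]); averaging
    over Gamma gives the theorem in the form of [resample_law].

    Two points complete the argument. The law of H is built from the data:
    u / s is a rotation-invariant random unit vector, and moving e1 to it, after
    an independent Haar rotation that fixes e1, gives a left-invariant matrix
    ([exists_left_haar]). The claimed conditional law does not depend on the
    frames, as two frames with the same first vector differ by some diag(1, C),
    which the Haar law absorbs ([inner_frame]); so the measurable frames given by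
    Householder reflections can stand for the arbitrary h1 and h2. *)

(** * Orthogonal matrices and the stabilizer of the first basis vector *)

Section orthogonal.
Context (R : realType).

Lemma orthogonalmx_mulmxT n (A : 'M[R]_n) : A *m A^T = 1%:M -> orthogonalmx A.
Proof. by move=> AAt; split=> //; exact: mulmx1C. Qed.

Lemma orthogonalmx1 n : orthogonalmx (1%:M : 'M[R]_n).
Proof. by apply: orthogonalmx_mulmxT; rewrite trmx1 mulmx1. Qed.

Lemma orthogonalmxT n (A : 'M[R]_n) : orthogonalmx A -> orthogonalmx A^T.
Proof. by move=> [AAt AtA]; split; rewrite trmxK. Qed.

Lemma orthogonalmxM n (A B : 'M[R]_n) :
  orthogonalmx A -> orthogonalmx B -> orthogonalmx (A *m B).
Proof.
move=> [AAt _] [BBt _]; apply: orthogonalmx_mulmxT.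
by rewrite trmx_mul mulmxA -(mulmxA A) BBt mulmx1.
Qed.

Definition diag1 n (C : 'M[R]_n) : 'M[R]_(1 + n) := block_mx 1%:M 0 0 C.

Lemma diag1M n (C D : 'M[R]_n) : diag1 C *m diag1 D = diag1 (C *m D).
Proof.
by rewrite /diag1 mulmx_block !mulmx0 !mul0mx !(addr0, add0r) mulmx1.
Qed.

Lemma diag1T n (C : 'M[R]_n) : (diag1 C)^T = diag1 C^T.
Proof. by rewrite /diag1 tr_block_mx trmx1 !trmx0. Qed.

Lemma diag1_orthogonal n (C : 'M[R]_n) :
  orthogonalmx C -> orthogonalmx (diag1 C).
Proof.
move=> [CCt _]; apply: orthogonalmx_mulmxT.
by rewrite diag1T diag1M CCt /diag1 -scalar_mx_block.
Qed.

Lemma eps1E m : eps1 R m = col_mx 1%:M 0.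
Proof.
apply/colP => i; rewrite !mxE andbT -val_eqE /=.
by case: splitP => k ->; rewrite !mxE ?ord1.
Qed.

Lemma diag1_eps1 m (C : 'M[R]_m) : diag1 C *m eps1 R m = eps1 R m.
Proof. by rewrite eps1E mul_block_col !mulmx0 mul0mx mulmx1 !addr0. Qed.

Lemma eps1_normalized m : (eps1 R m)^T *m eps1 R m = 1%:M.
Proof. by rewrite eps1E tr_col_mx mul_row_col trmx1 mulmx1 trmx0 mulmx0 addr0. Qed.

(** If M fixes e1 then so does M^T, as M is orthogonal: this clears the first
    row as well as the first column. *)
Lemma orthogonal_fix_eps1 m (M : 'M[R]_(1 + m)) : orthogonalmx M ->
  M *m eps1 R m = eps1 R m -> exists2 C, orthogonalmx C & M = diag1 C.
Proof.
move=> [MMt MtM] Me.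
have Mte : M^T *m eps1 R m = eps1 R m by rewrite -[in LHS]Me mulmxA MtM mul1mx.
move: MMt Mte Me; rewrite -[M]submxK.
move: (ulsubmx M) (ursubmx M) (dlsubmx M) (drsubmx M) => a b c C.
rewrite tr_block_mx mulmx_block (scalar_mx_block 1 m 1) => /eq_block_mx[_ _ _].
rewrite eps1E !mul_block_col !mulmx0 !mulmx1 !addr0 => CCt.
move=> /eq_col_mx[_ b0] /eq_col_mx[-> c0]; move: CCt.
rewrite -[b]trmxK b0 c0 !trmx0 mul0mx add0r => CCt.
by exists C => //; exact: orthogonalmx_mulmxT.
Qed.

(** The frames with a given first vector form one coset of the stabilizer of
    that vector. *)
Lemma orthogonal_eps1_eq m (K L : 'M[R]_(1 + m)) :
  orthogonalmx K -> orthogonalmx L -> K *m eps1 R m = L *m eps1 R m ->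
  exists2 C, orthogonalmx C & L = K *m diag1 C.
Proof.
move=> oK oL KL; have [KKt KtK] := oK.
have [||C oC E] := @orthogonal_fix_eps1 _ (K^T *m L).
- exact: orthogonalmxM (orthogonalmxT oK) oL.
- by rewrite -mulmxA -KL mulmxA KtK mul1mx.
by exists C => //; rewrite -E mulmxA KKt mul1mx.
Qed.

End orthogonal.

(** * Householder reflections *)

Section householder.
Context (R : realType) (m : nat).
Implicit Type x : 'cV[R]_(1 + m).

Definition sqnorm x : R := (x^T *m x) 0 0.

Lemma sqnormE x : x^T *m x = (sqnorm x)%:M.
Proof. exact: mx11_scalar. Qed.

Lemma sqnormZ (c : R) x : sqnorm (c *: x) = c ^+ 2 * sqnorm x.
Proof.
by rewrite /sqnorm [(_ *: _)^T]linearZ /= -scalemxAl -scalemxAr scalerA mxE -expr2.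
Qed.

Lemma sqnorm_ge0 x : 0 <= sqnorm x.
Proof. by rewrite /sqnorm mxE sumr_ge0// => i _; rewrite !mxE -expr2 sqr_ge0. Qed.

Lemma sqnorm_eq0 x : (sqnorm x == 0) = (x == 0).
Proof.
apply/eqP/eqP => [|->]; last by rewrite /sqnorm mulmx0 mxE.
rewrite /sqnorm mxE => /eqP; rewrite psumr_eq0 => [/allP xx0|i _]; last first.
  by rewrite !mxE -expr2 sqr_ge0.
apply/colP => i; have := xx0 i (mem_index_enum _).
by rewrite !mxE -expr2 sqrf_eq0 => /eqP.
Qed.

(** A frame with first vector x given by a single measurable formula. At
    x = eps1, where no reflection is needed, the convention 0^-1 = 0 makes it
    the identity. *)
Definition householder x : 'M[R]_(1 + m) :=
  let w := x - eps1 R m in 1%:M - (2 / sqnorm w) *: (w *m w^T).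

Lemma householder_orthogonal x : orthogonalmx (householder x).
Proof.
rewrite /householder; move: (x - _) => w; set c := _ / _.
have cE : c * c * sqnorm w = c + c.
  rewrite /c; have [->|w0] := eqVneq (sqnorm w) 0; last by field.
  by rewrite invr0 !mulr0 addr0.
have sym : (1%:M - c *: (w *m w^T))^T = 1%:M - c *: (w *m w^T).
  by rewrite raddfB /= trmx1 linearZ /= trmx_mul trmxK.
apply: orthogonalmx_mulmxT; rewrite sym mulmxBl !mulmxBr !mul1mx mulmx1.
have -> : c *: (w *m w^T) *m (c *: (w *m w^T)) = (c + c) *: (w *m w^T).
  rewrite -scalemxAl -scalemxAr scalerA mulmxA -(mulmxA w) sqnormE.
  by rewrite mul_mx_scalar -scalemxAl scalerA cE.
by rewrite scalerDl opprB addrK subrK.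
Qed.

Lemma householder_eps1 x : sqnorm x = 1 -> householder x *m eps1 R m = x.
Proof.
move=> x1; rewrite /householder; set w := x - _.
have wT : w^T = x^T - (eps1 R m)^T by rewrite /w raddfB.
have wx : w^T *m eps1 R m = (- (sqnorm w / 2))%:M.
  have ex : (eps1 R m)^T *m x = x^T *m eps1 R m.
    by apply/matrixP => i j; rewrite !mxE; apply: eq_bigr => k _;
      rewrite !mxE !ord1 mulrC.
  have : (sqnorm w)%:M = 2 *: (1%:M - x^T *m eps1 R m).
    rewrite -sqnormE wT mulmxBl /w !mulmxBr ex sqnormE x1 eps1_normalized.
    by rewrite opprB addrA scaler_nat mulr2n addrA addrAC.
  rewrite wT mulmxBl eps1_normalized => E.
  have n2 : (2 : R) != 0 by rewrite pnatr_eq0.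
  apply: (scalerI n2); rewrite scale_scalar_mx mulrN mulrC divfK// raddfN /= E.
  by rewrite -scalerN opprB.
rewrite mulmxBl mul1mx -scalemxAl -mulmxA wx mul_mx_scalar scalerA.
have [w0|w0] := eqVneq w 0.
  by move: (w0) => /eqP; rewrite subr_eq0 => /eqP ->; rewrite w0 scaler0 subr0.
have -> : 2 / sqnorm w * - (sqnorm w / 2) = -1.
  by field; rewrite sqnorm_eq0.
by rewrite scaleN1r opprK addrC subrK.
Qed.

End householder.

(** * Orthogonal matrices with a given border *)

Section border.
Context (R : realType) (m : nat).
Implicit Types (G : 'M[R]_(1 + (1 + m)))
  (b : 'cV[R]_(1 + m) * 'rV[R]_(1 + m) * R).

Definition col_dir b : 'cV[R]_(1 + m) := (Num.sqrt (1 - b.2 ^+ 2))^-1 *: b.1.1.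
Definition row_dir b : 'cV[R]_(1 + m) := (Num.sqrt (1 - b.2 ^+ 2))^-1 *: b.1.2^T.

Lemma border_block G :
  G = block_mx (border G).2%:M (border G).1.2 (border G).1.1 (drsubmx G).
Proof. by rewrite /= /corner -mx11_scalar submxK. Qed.

Lemma block_diag1r a (v : 'rV_(1 + m)) (u : 'cV_(1 + m)) M (H : 'M[R]_(1 + m)) :
  block_mx a%:M v u M *m diag1 H = block_mx a%:M (v *m H) u (M *m H).
Proof. by rewrite mulmx_block !mulmx0 !mulmx1 !(addr0, add0r). Qed.

Lemma block_diag1l a (v : 'rV_(1 + m)) (u : 'cV_(1 + m)) M (H : 'M[R]_(1 + m)) :
  diag1 H *m block_mx a%:M v u M = block_mx a%:M v (H *m u) (H *m M).
Proof. by rewrite mulmx_block !mul0mx !mul1mx !(addr0, add0r). Qed.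

Lemma border_blockE a (v : 'rV_(1 + m)) (u : 'cV_(1 + m)) M :
  border (block_mx (a%:M : 'M[R]_1) v u M) = (u, v, a).
Proof.
by rewrite /border /corner block_mxKul block_mxKur block_mxKdl mxE mulr1n.
Qed.

Lemma border_diag1r G H :
  border (G *m diag1 H) = ((border G).1.1, (border G).1.2 *m H, (border G).2).
Proof. by rewrite {1}[G]border_block block_diag1r border_blockE. Qed.

Lemma border_diag1l G H :
  border (diag1 H *m G) = (H *m (border G).1.1, (border G).1.2, (border G).2).
Proof. by rewrite {1}[G]border_block block_diag1l border_blockE. Qed.

Lemma orthogonal_nocorner_diag1r G H : orthogonal_nocorner G ->
  orthogonalmx H -> orthogonal_nocorner (G *m diag1 H).
Proof.
move=> [oG aG] oH; split; first exact: orthogonalmxM (diag1_orthogonal oH).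
by rewrite -[corner _]/(border _).2 border_diag1r.
Qed.

Lemma orthogonal_nocorner_diag1l G H : orthogonal_nocorner G ->
  orthogonalmx H -> orthogonal_nocorner (diag1 H *m G).
Proof.
move=> [oG aG] oH; split; first exact: orthogonalmxM (diag1_orthogonal oH) _.
by rewrite -[corner _]/(border _).2 border_diag1l.
Qed.

Lemma orthogonal_blocks G (b := border G) : orthogonalmx G ->
  [/\ b.1.2 *m b.1.2^T = (1 - b.2 ^+ 2)%:M,
      b.1.1^T *m b.1.1 = (1 - b.2 ^+ 2)%:M,
      drsubmx G *m b.1.2^T = - b.2 *: b.1.1,
      b.1.1^T *m drsubmx G = - b.2 *: b.1.2 &
      drsubmx G *m (drsubmx G)^T = 1%:M - b.1.1 *m b.1.1^T].
Proof.
rewrite {1}[G]border_block -/b; move: b (drsubmx G) => [[u v] a] M /=.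
case; rewrite !tr_block_mx !mulmx_block tr_scalar_mx !(scalar_mx_block 1 (1 + m) 1).
rewrite -!scalar_mxM !mul_scalar_mx !mul_mx_scalar.
move=> /eq_block_mx[vv _ Mv MM] /eq_block_mx[uu uM _ _]; split.
- by rewrite raddfB /= -vv -expr2 addrAC subrr add0r.
- by rewrite raddfB /= -uu -expr2 addrAC subrr add0r.
- by apply/eqP; rewrite scaleNr -addr_eq0 addrC Mv.
- by apply/eqP; rewrite scaleNr -addr_eq0 addrC uM.
- by rewrite -MM addrAC subrr add0r.
Qed.

End border.

Section inner_structure.
Context (R : realType) (m : nat).
Implicit Types (G : 'M[R]_(1 + (1 + m))) (K L : 'M[R]_(1 + m)) (C D : 'M[R]_m).

Lemma corner_lt1 G : orthogonal_nocorner G -> 0 < 1 - (border G).2 ^+ 2.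
Proof.
move=> [oG [aN1 a1]]; have [_ uu _ _ _] := orthogonal_blocks oG.
rewrite lt_neqAle; apply/andP; split.
  by rewrite eq_sym subr_eq0 eq_sym sqrf_eq1 negb_or; exact/andP.
by have := sqnorm_ge0 (border G).1.1; rewrite /sqnorm uu mxE mulr1n.
Qed.

Lemma sqnorm_col_dir G : orthogonal_nocorner G -> sqnorm (col_dir (border G)) = 1.
Proof.
move=> nG; have a1 := corner_lt1 nG; case: nG => oG _.
have [_ uu _ _ _] := orthogonal_blocks oG.
rewrite sqnormZ exprVn sqr_sqrtr ?ltW// /sqnorm uu mxE mulr1n mulVf//.
by rewrite gt_eqF.
Qed.

Lemma sqnorm_row_dir G : orthogonal_nocorner G -> sqnorm (row_dir (border G)) = 1.
Proof.
move=> nG; have a1 := corner_lt1 nG; case: nG => oG _.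
have [vv _ _ _ _] := orthogonal_blocks oG.
rewrite sqnormZ exprVn sqr_sqrtr ?ltW// /sqnorm trmxK vv mxE mulr1n mulVf//.
by rewrite gt_eqF.
Qed.

Definition core (a : R) C : 'M[R]_(1 + m) := block_mx (- a)%:M 0 0 C.

Lemma core_diag1r a C D : core a C *m diag1 D = core a (C *m D).
Proof.
by rewrite mulmx_block !mulmx0 !mul0mx !mulmx1 !(addr0, add0r).
Qed.

Lemma core_diag1l a C D : diag1 C *m core a D = core a (C *m D).
Proof.
by rewrite mulmx_block !mulmx0 !mul0mx !mul1mx !(addr0, add0r).
Qed.

Lemma coreE (a : R) (M : 'M[R]_(1 + m)) : M *m eps1 R m = - a *: eps1 R m ->
  M^T *m eps1 R m = - a *: eps1 R m -> M = core a (drsubmx M).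
Proof.
rewrite -[M]submxK.
move: (ulsubmx M) (ursubmx M) (dlsubmx M) (drsubmx M) => x b c C.
rewrite tr_block_mx eps1E !mul_block_col !mulmx0 !mulmx1 !addr0 block_mxKdr.
rewrite scale_col_mx scaler0 scale_scalar_mx mulr1.
move=> /eq_col_mx[-> ->] /eq_col_mx[_ b0].
by rewrite -[b]trmxK b0 trmx0.
Qed.

(** Orthogonality of G says that the inner block sends row_dir to
    - a col_dir, its transpose sends col_dir to - a row_dir, and it is an
    isometry between their orthogonal complements. *)
Lemma drsubmx_factor G K L : orthogonal_nocorner G ->
  orthogonalmx K -> K *m eps1 R m = col_dir (border G) ->
  orthogonalmx L -> L *m eps1 R m = row_dir (border G) ->
  exists2 C, orthogonalmx C & drsubmx G = K *m core (border G).2 C *m L^T.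
Proof.
move=> nG [KKt KtK] Ke [LLt LtL] Le; have a1 := corner_lt1 nG; case: nG => oG _.
have [_ _ Gv uG GG] := orthogonal_blocks oG.
set a := (border G).2 in a1 Gv uG GG *; set s := Num.sqrt (1 - a ^+ 2).
have s0 : s != 0 by rewrite gt_eqF// sqrtr_gt0.
have uE : (border G).1.1 = s *: (K *m eps1 R m).
  by rewrite Ke scalerA divff// scale1r.
have vE : (border G).1.2^T = s *: (L *m eps1 R m).
  by rewrite Le scalerA divff// scale1r.
have uGt : (drsubmx G)^T *m (border G).1.1 = - a *: (border G).1.2^T.
  by rewrite -[LHS]trmxK trmx_mul trmxK uG [(_ *: _)^T]linearZ.
pose M := K^T *m drsubmx G *m L.
have Me : M *m eps1 R m = - a *: eps1 R m.
  rewrite /M -!mulmxA Le /row_dir -!scalemxAr Gv -/a -/s uE -!scalemxAr.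
  by rewrite mulmxA KtK mul1mx !scalerA mulrAC mulVf// mul1r.
have Mte : M^T *m eps1 R m = - a *: eps1 R m.
  rewrite /M !trmx_mul trmxK -!mulmxA Ke /col_dir -!scalemxAr uGt vE -/a -/s.
  rewrite -!scalemxAr.
  by rewrite mulmxA LtL mul1mx !scalerA mulrAC mulVf// mul1r.
have ME := coreE Me Mte; exists (drsubmx M); last first.
  by rewrite -ME /M !mulmxA KKt mul1mx -mulmxA LLt mulmx1.
have MMt : M *m M^T = 1%:M - s ^+ 2 *: (eps1 R m *m (eps1 R m)^T).
  rewrite /M !trmx_mul trmxK -!mulmxA (mulmxA L) LLt mul1mx (mulmxA (drsubmx G)) GG.
  rewrite mulmxBl mul1mx mulmxBr KtK; congr (_ - _).
  rewrite uE [(_ *: _)^T]linearZ /= -?(scalemxAl, scalemxAr) scalerA.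
  rewrite -?scalemxAr -expr2.
  congr (_ *: _).
  by rewrite trmx_mul -!mulmxA KtK mulmx1 !mulmxA KtK mul1mx.
apply: orthogonalmx_mulmxT; move: MMt; rewrite {1 2}ME tr_block_mx mulmx_block.
rewrite eps1E tr_col_mx mul_col_row scale_block_mx (scalar_mx_block 1 m 1).
rewrite opp_block_mx add_block_mx !trmx0 !mulmx0 !add0r => /eq_block_mx[_ _ _ ->].
by rewrite scaler0 subr0.
Qed.

(** Right multiplication by diag(1, g) moves the first row of G and its inner
    block together; taking g = L diag(1, C^T D), with C as in [drsubmx_factor],
    straightens the row along e1 and trades C for D. *)
Lemma orthogonal_nocorner_coset G K L D : orthogonal_nocorner G ->
  orthogonalmx K -> K *m eps1 R m = col_dir (border G) ->
  orthogonalmx L -> L *m eps1 R m = row_dir (border G) ->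
  orthogonalmx D ->
  exists2 g, orthogonalmx g & G *m diag1 g =
    block_mx (border G).2%:M (Num.sqrt (1 - (border G).2 ^+ 2) *: (eps1 R m)^T)
             (border G).1.1 (K *m core (border G).2 D).
Proof.
move=> nG oK Ke oL Le oD; have a1 := corner_lt1 nG.
have [C oC GE] := drsubmx_factor nG oK Ke oL Le.
exists (L *m diag1 (C^T *m D)).
  apply: orthogonalmxM => //; apply: diag1_orthogonal.
  exact: orthogonalmxM (orthogonalmxT oC) oD.
rewrite {1}[G]border_block block_diag1r.
case: oL => _ LtL; case: oC => CCt _; congr block_mx; last first.
  by rewrite GE -!mulmxA (mulmxA L^T) LtL mul1mx core_diag1r mulmxA CCt mul1mx.
set s := Num.sqrt _; have s0 : s != 0 by rewrite gt_eqF// sqrtr_gt0.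
have -> : (border G).1.2 = s *: (L *m eps1 R m)^T.
  by rewrite Le linearZ /= trmxK scalerA divff// scale1r.
rewrite -scalemxAl; congr (_ *: _); rewrite trmx_mul -mulmxA (mulmxA L^T) LtL mul1mx.
by rewrite -[LHS]trmxK trmx_mul trmxK diag1T diag1_eps1.
Qed.

End inner_structure.

(** * Measurability of matrix-valued functions *)

Section matrix_measurability.
Context d (U : measurableType d) (R : realType).

Lemma measurable_mulmx p q r (f : U -> 'M[R]_(p, q)) (g : U -> 'M[R]_(q, r)) :
  measurable_fun setT f -> measurable_fun setT g ->
  measurable_fun setT (fun u => f u *m g u).
Proof.
move=> /measurable_fun_mxP mf /measurable_fun_mxP mg.
apply/measurable_fun_mxP => i j; under eq_fun do rewrite mxE.
by apply: measurable_sum => k; exact: measurable_funM.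
Qed.

Lemma measurable_trmx p q (f : U -> 'M[R]_(p, q)) :
  measurable_fun setT f -> measurable_fun setT (fun u => (f u)^T).
Proof.
move=> /measurable_fun_mxP mf; apply/measurable_fun_mxP => i j.
by under eq_fun do rewrite mxE; exact: mf.
Qed.

Lemma measurable_mxB p q (f g : U -> 'M[R]_(p, q)) :
  measurable_fun setT f -> measurable_fun setT g ->
  measurable_fun setT (fun u => f u - g u).
Proof.
move=> /measurable_fun_mxP mf /measurable_fun_mxP mg.
apply/measurable_fun_mxP => i j; under eq_fun do rewrite !mxE.
exact: measurable_funB.
Qed.

Lemma measurable_mxZ p q (c : U -> R) (f : U -> 'M[R]_(p, q)) :
  measurable_fun setT c -> measurable_fun setT f ->
  measurable_fun setT (fun u => c u *: f u).
Proof.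
move=> mc /measurable_fun_mxP mf.
apply/measurable_fun_mxP => i j; under eq_fun do rewrite !mxE.
exact: measurable_funM.
Qed.

Lemma measurable_scalar_mx n (c : U -> R) :
  measurable_fun setT c -> measurable_fun setT (fun u => (c u)%:M : 'M[R]_n).
Proof.
move=> mc; apply/measurable_fun_mxP => i j; under eq_fun do rewrite !mxE.
case: (i == j) => /=; first by under eq_fun do rewrite mulr1n; exact: mc.
by under eq_fun do rewrite mulr0n; exact: measurable_cst.
Qed.

Lemma measurable_block_mx p q r s (f : U -> 'M[R]_(p, q)) (g : U -> 'M[R]_(p, r))
    (h : U -> 'M[R]_(s, q)) (k : U -> 'M[R]_(s, r)) :
  measurable_fun setT f -> measurable_fun setT g ->
  measurable_fun setT h -> measurable_fun setT k ->
  measurable_fun setT (fun u => block_mx (f u) (g u) (h u) (k u)).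
Proof.
move=> /measurable_fun_mxP mf /measurable_fun_mxP mg.
move=> /measurable_fun_mxP mh /measurable_fun_mxP mk.
apply/measurable_fun_mxP => i j.
rewrite -(splitK i) -(splitK j).
case: (fintype.split i) => i'; case: (fintype.split j) => j' /=.
- by under eq_fun do rewrite block_mxEul; exact: mf.
- by under eq_fun do rewrite block_mxEur; exact: mg.
- by under eq_fun do rewrite block_mxEdl; exact: mh.
- by under eq_fun do rewrite block_mxEdr; exact: mk.
Qed.

Lemma measurable_invr (f : U -> R) : (forall u, 0 <= f u) ->
  measurable_fun setT f -> measurable_fun setT (fun u => (f u)^-1).
Proof.
move=> f0 mf; under eq_fun do rewrite -powR_inv1//.
exact: (measurableT_comp (measurable_powR _)).
Qed.

Lemma measurable_sqrt (f : U -> R) :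
  measurable_fun setT f -> measurable_fun setT (fun u => Num.sqrt (f u)).
Proof.
move=> mf; apply: (measurableT_comp _ mf); apply: continuous_measurable_fun.
exact: sqrt_continuous.
Qed.

Lemma measurable_householder m (f : U -> 'cV[R]_(1 + m)) :
  measurable_fun setT f -> measurable_fun setT (fun u => householder (f u)).
Proof.
move=> mf; have mw : measurable_fun setT (fun u => f u - eps1 R m).
  by apply: measurable_mxB.
rewrite /householder; apply: measurable_mxB => //; apply: measurable_mxZ.
  apply: measurable_funM => //.
  apply: measurable_invr => [u|]; first exact: sqnorm_ge0.
  have := measurable_mulmx (measurable_trmx mw) mw.
  by move=> /measurable_fun_mxP; exact.
by apply: measurable_mulmx => //; exact: measurable_trmx.
Qed.

End matrix_measurability.

Section matrix_sets.
Context (R : realType).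

Lemma measurable_mx_set1 m n (M : 'M[R]_(m, n)) : measurable [set M].
Proof.
have -> : [set M] = \bigcap_(ij in [set: 'I_m * 'I_n])
    (fun N : 'M[R]_(m, n) => N ij.1 ij.2) @^-1` [set M ij.1 ij.2].
  apply/seteqP; split => [_ -> //|N NM].
  by apply/matrixP => i j; exact: (NM (i, j)).
apply: fin_bigcap_measurable => // ij _.
by rewrite -[X in measurable X]setTI; apply: measurable_entry.
Qed.

Lemma measurable_orthogonalmx n : measurable [set M : 'M[R]_n | orthogonalmx M].
Proof.
have mt : measurable_fun setT (@trmx R n n) by exact: measurable_trmx.
rewrite (_ : mkset _ = (fun M => M *m M^T) @^-1` [set 1%:M] `&`
  (fun M => M^T *m M) @^-1` [set 1%:M])//.
apply: measurableI; rewrite -[X in measurable X]setTI.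
- by apply: measurable_mulmx => //; exact: measurable_mx_set1.
- by apply: measurable_mulmx => //; exact: measurable_mx_set1.
Qed.

End matrix_sets.

(** * Almost sure equality and sections of measurable sets *)

Section invariance.
Local Open Scope ereal_scope.
Context d (X : measurableType d) (R : realType) (mu : probability X R).

Lemma integral_invariant (f : X -> X) (F : X -> \bar R) :
  measurable_fun setT f -> (forall A, measurable A -> mu (f @^-1` A) = mu A) ->
  measurable_fun setT F -> (forall x, 0 <= F x) ->
  \int[mu]_x F (f x) = \int[mu]_x F x.
Proof.
move=> mf muf mF F0.
have := @ge0_integral_pushforward _ _ _ _ R f mf mu setT F measurableT mF
  (fun y _ => F0 y).
rewrite preimage_setT => <-; apply: eq_measure_integral => A mA _; exact: muf.
Qed.

Lemma eq_integral_prob_on (O : set X) (F G : X -> \bar R) :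
  measurable O -> mu O = 1 ->
  measurable_fun setT F -> measurable_fun setT G ->
  (forall x, 0 <= F x) -> (forall x, 0 <= G x) ->
  (forall x, O x -> F x = G x) ->
  \int[mu]_x F x = \int[mu]_x G x.
Proof.
move=> mO muO mF mG F0 G0 FG; apply: ge0_ae_eq_integral => //.
exists (~` O); split; first exact: measurableC.
  by have := probability_setC mu mO; rewrite muO subee.
by move=> x; apply: contra_not => Ox _; exact: FG.
Qed.

Lemma eq_prob_on (O A B : set X) : measurable O -> mu O = 1 ->
  measurable A -> measurable B -> (forall x, O x -> A x <-> B x) -> mu A = mu B.
Proof.
move=> mO muO mA mB AB.
rewrite -(setIT A) -(setIT B) -!integral_indic//.
apply: (eq_integral_prob_on mO muO) => //.
- by apply/measurable_EFinP; exact: measurable_indic.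
- by apply/measurable_EFinP; exact: measurable_indic.
move=> x Ox; rewrite !indicE; suff -> : (x \in A) = (x \in B) by [].
by apply/idP/idP; rewrite !inE => ?; apply/AB.
Qed.

Lemma probE_integral_indic d' (Y : measurableType d') (f : X -> Y) (C : set Y) :
  measurable_fun setT f -> measurable C ->
  mu [set x | C (f x)] = \int[mu]_x (\1_C (f x))%:E.
Proof.
move=> mf mC; rewrite -[LHS](congr1 mu (setIT _)) -integral_indic//.
by rewrite -[X in measurable X]setTI; exact: mf.
Qed.

End invariance.

Section section_swap.
Local Open Scope ereal_scope.
Context d1 d2 (X : measurableType d1) (Y : measurableType d2) (R : realType)
  (mu : probability X R) (nu : probability Y R).

Lemma measurable_prob_section (E : X -> Y -> Prop) :
  measurable [set xy | E xy.1 xy.2] ->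
  measurable_fun setT (fun x => nu [set y | E x y]).
Proof.
move=> mE; have := measurable_fun_xsection nu mE.
by congr measurable_fun; apply/funext => x /=; congr (nu _); apply/seteqP; split=> y;
  rewrite /xsection /= inE.
Qed.

Lemma integral_prob_section (E : X -> Y -> Prop) :
  measurable [set xy | E xy.1 xy.2] ->
  \int[mu]_x nu [set y | E x y] = \int[nu]_y mu [set x | E x y].
Proof.
move=> mE; have := indic_fubini_tonelli mu nu mE.
rewrite indic_fubini_tonelli_FE// indic_fubini_tonelli_GE//.
move=> H; transitivity (\int[mu]_x (nu \o xsection [set xy | E xy.1 xy.2]) x).
  apply: eq_integral => x _ /=; congr (nu _).
  by apply/seteqP; split=> y; rewrite /xsection /= inE.
rewrite H; apply: eq_integral => y _ /=; congr (mu _).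
by apply/seteqP; split=> x; rewrite /ysection /= inE.
Qed.

End section_swap.

(** * Resampling the inner block *)

Section inner_block.
Context (R : realType) (m : nat).
Local Notation bdr := ('cV[R]_(1 + m) * 'rV[R]_(1 + m) * R)%type.
Implicit Types (b : bdr) (D : 'M[R]_m).

Definition inner b D : 'M[R]_(1 + m) :=
  householder (col_dir b) *m core b.2 D *m (householder (row_dir b))^T.

Definition resample b D : 'M[R]_(1 + (1 + m)) :=
  block_mx b.2%:M b.1.2 b.1.1 (inner b D).

Lemma measurable_core :
  measurable_fun setT (fun bD : bdr * 'M[R]_m => core bD.1.2 bD.2).
Proof.
apply: measurable_block_mx => //; apply: measurable_scalar_mx.
by apply: measurableT_comp => //; apply: measurableT_comp.
Qed.

Lemma measurable_col_dir : measurable_fun setT (@col_dir R m).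
Proof.
apply: measurable_mxZ; last exact: measurableT_comp.
apply: measurable_invr => [b|]; first exact: sqrtr_ge0.
by apply: measurable_sqrt; apply: measurable_funB => //; exact: measurable_funX.
Qed.

Lemma measurable_row_dir : measurable_fun setT (@row_dir R m).
Proof.
apply: measurable_mxZ; last first.
  by apply: measurable_trmx; exact: measurableT_comp.
apply: measurable_invr => [b|]; first exact: sqrtr_ge0.
by apply: measurable_sqrt; apply: measurable_funB => //; exact: measurable_funX.
Qed.

Lemma measurable_inner :
  measurable_fun setT (fun bD : bdr * 'M[R]_m => inner bD.1 bD.2).
Proof.
apply: measurable_mulmx.
  apply: measurable_mulmx; last exact: measurable_core.
  by apply: measurable_householder; exact: (measurableT_comp measurable_col_dir).
apply: measurable_trmx; apply: measurable_householder.
exact: (measurableT_comp measurable_row_dir).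
Qed.

Lemma measurable_resample :
  measurable_fun setT (fun bD : bdr * 'M[R]_m => resample bD.1 bD.2).
Proof.
apply: measurable_block_mx; last exact: measurable_inner.
- by apply: measurable_scalar_mx; do 2 apply: measurableT_comp => //.
- by do 2 apply: measurableT_comp => //.
- by do 2 apply: measurableT_comp => //.
Qed.

Lemma haar_mul (mu : probability 'M[R]_m R) C C' (A : set 'M[R]_m) :
  is_haar mu -> orthogonalmx C -> orthogonalmx C' -> measurable A ->
  mu [set D | A (C *m D *m C')] = mu A.
Proof.
move=> [_ muM] oC oC' mA; have mAC' : measurable [set D | A (D *m C')].
  by rewrite -[X in measurable X]setTI; apply: measurable_mulmx.
by rewrite ((muM C oC _ mAC').1) ((muM C' oC' _ mA).2).
Qed.

(** Two choices of frames differ by diag(1, C1) and diag(1, C2), which turns the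
    core diag(-a, D) into diag(-a, C1 D C2^T); the two-sided invariance of the
    Haar law removes C1 and C2. *)
Lemma inner_frame (mu : probability 'M[R]_m R) (G : 'M[R]_(1 + (1 + m)))
    (K L : 'M[R]_(1 + m)) (B : set 'M[R]_(1 + m)) :
  is_haar mu -> orthogonal_nocorner G ->
  orthogonalmx K -> K *m eps1 R m = col_dir (border G) ->
  orthogonalmx L -> L *m eps1 R m = row_dir (border G) ->
  measurable B ->
  mu [set D | B (K *m core (border G).2 D *m L^T)] =
  mu [set D | B (inner (border G) D)].
Proof.
move=> muH nG oK Ke oL Le mB; set b := border G in Ke Le *.
have [C1 oC1 ->] : exists2 C, orthogonalmx C &
    K = householder (col_dir b) *m diag1 C.
  apply: orthogonal_eps1_eq => //; first exact: householder_orthogonal.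
  by rewrite Ke householder_eps1// sqnorm_col_dir.
have [C2 oC2 ->] : exists2 C, orthogonalmx C &
    L = householder (row_dir b) *m diag1 C.
  apply: orthogonal_eps1_eq => //; first exact: householder_orthogonal.
  by rewrite Le householder_eps1// sqnorm_row_dir.
have mA : measurable [set D | B (inner b D)].
  rewrite -[X in measurable X]setTI.
  exact: (measurable_fun_pair2 _ measurable_inner).
have frameE D : householder (col_dir b) *m diag1 C1 *m core b.2 D *m
    (householder (row_dir b) *m diag1 C2)^T = inner b (C1 *m D *m C2^T).
  by rewrite /inner -core_diag1r -core_diag1l trmx_mul diag1T !mulmxA.
rewrite -(haar_mul muH oC1 (orthogonalmxT oC2) mA); congr (mu _).
by apply/seteqP; split => D /=; rewrite frameE.
Qed.

End inner_block.

(** * The Haar law is invariant under resampling the inner block *)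

Section resampling.
Context (R : realType) (m : nat) (d : measure_display) (T : measurableType d)
  (P : probability T R) (Gam : {RV P >-> 'M[R]_(1 + (1 + m))})
  (delta : probability 'M[R]_m R).
Context (Gam_haar : is_haar (distribution P Gam)).
Context (Gam_sample : forall t, orthogonal_nocorner (Gam t)).
Context (delta_haar : is_haar delta).

Local Open Scope ereal_scope.

Let measurable_Gam : measurable_fun setT (Gam : T -> 'M[R]_(1 + (1 + m))).
Proof. exact: measurable_funPT. Qed.

Lemma integral_haar_mull g (F : 'M[R]_(1 + (1 + m)) -> \bar R) :
  orthogonalmx g -> measurable_fun setT F -> (forall x, 0 <= F x) ->
  \int[P]_t F (g *m Gam t) = \int[P]_t F (Gam t).
Proof.
move=> og mF F0.
have mg : measurable_fun setT (fun G : 'M[R]_(1 + (1 + m)) => g *m G).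
  by apply: measurable_mulmx; [exact: measurable_cst|exact: measurable_id].
rewrite -(ge0_integral_distribution Gam (f := fun G => F (g *m G)))//;
  last first.
  exact: measurableT_comp.
rewrite -(ge0_integral_distribution Gam (f := F))//.
by apply: integral_invariant => // A mA; exact: (Gam_haar.2 g og A mA).1.
Qed.

Lemma integral_haar_mulr g (F : 'M[R]_(1 + (1 + m)) -> \bar R) :
  orthogonalmx g -> measurable_fun setT F -> (forall x, 0 <= F x) ->
  \int[P]_t F (Gam t *m g) = \int[P]_t F (Gam t).
Proof.
move=> og mF F0.
have mg : measurable_fun setT (fun G : 'M[R]_(1 + (1 + m)) => G *m g).
  by apply: measurable_mulmx; [exact: measurable_id|exact: measurable_cst].
rewrite -(ge0_integral_distribution Gam (f := fun G => F (G *m g)))//;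
  last first.
  exact: measurableT_comp.
rewrite -(ge0_integral_distribution Gam (f := F))//.
by apply: integral_invariant => // A mA; exact: (Gam_haar.2 g og A mA).2.
Qed.

(** H = h(u / s) diag(1, D), where h(x) is the Householder frame of x, u / s is
    the direction of the first column of Gamma, and D is an independent Haar
    matrix. For g orthogonal, g h(x) and h(g x) differ by some diag(1, C) on the
    right, absorbed by D, and g u / s has the law of u / s because diag(1, g)
    preserves the law of Gamma. *)
Lemma exists_left_haar : exists eta : probability 'M[R]_(1 + m) R,
  eta [set H | orthogonalmx H] = 1 /\
  forall g, orthogonalmx g -> forall A, measurable A ->
    eta [set H | A (g *m H)] = eta A.
Proof.
pose hG (G : 'M[R]_(1 + (1 + m))) : 'M[R]_(1 + m) :=
  householder (col_dir (border G)).
have mhG : measurable_fun setT hG.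
  apply: measurable_householder.
  exact: (measurableT_comp (@measurable_col_dir R m) (@measurable_border R m)).
have mGD : measurable_fun setT
    (fun GD : 'M[R]_(1 + (1 + m)) * 'M[R]_m => hG GD.1 *m diag1 GD.2).
  apply: measurable_mulmx; first exact: measurableT_comp.
  exact: measurable_block_mx.
pose phi (tD : T * 'M[R]_m) := hG (Gam tD.1) *m diag1 tD.2.
have mphi : measurable_fun setT phi.
  apply: (measurableT_comp mGD (g := fun tD : T * 'M[R]_m => (Gam tD.1, tD.2))).
  by apply: measurable_fun_pair => //; exact: measurableT_comp.
pose Phi : {mfun _ >-> _} := HB.pack phi (isMeasurableFun.Build _ _ _ _ phi mphi).
pose eta : probability _ R := distribution (P \x delta) Phi.
pose psi A G := delta [set D | A (hG G *m diag1 D)].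
have mpsi A : measurable A -> measurable_fun setT (psi A).
  move=> mA.
  apply: (measurable_prob_section delta (E := fun G D => A (hG G *m diag1 D))).
  by rewrite -[X in measurable X]setTI; exact: mGD.
have etaE A : measurable A -> eta A = \int[P]_t psi A (Gam t).
  move=> mA; rewrite /eta /distribution /pushforward /=.
  apply: eq_integral => t _ /=; congr (delta _).
  by apply/seteqP; split => D; rewrite /xsection /= inE.
exists eta; split.
  rewrite etaE; last exact: measurable_orthogonalmx.
  rewrite -[RHS](probability_setT P) -[RHS]mul1e -integral_cst//.
  apply: eq_integral => t _; rewrite /psi /= -(probability_setT delta).
  apply: (eq_prob_on (@measurable_orthogonalmx R m) delta_haar.1) => //.
    rewrite -[X in measurable X]setTI.
    apply: (measurable_fun_pair2 (Gam t) mGD) => //; exact: measurable_orthogonalmx.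
  move=> D /= oD; split => // _; apply: orthogonalmxM.
    exact: householder_orthogonal.
  exact: diag1_orthogonal.
move=> g og A mA.
have mgA : measurable [set H | A (g *m H)].
  by rewrite -[X in measurable X]setTI; apply: measurable_mulmx.
rewrite !etaE//.
rewrite -(integral_haar_mull (diag1_orthogonal og) (mpsi _ mA)
  (fun=> measure_ge0 _ _)).
apply: eq_integral => t _; rewrite /psi.
set G := Gam t; have nG : orthogonal_nocorner G by exact: Gam_sample.
have [|||C oC gE] := @orthogonal_eps1_eq R m (hG (diag1 g *m G)) (g *m hG G).
- exact: householder_orthogonal.
- by apply: orthogonalmxM => //; exact: householder_orthogonal.
- rewrite -mulmxA !householder_eps1 ?sqnorm_col_dir//; last first.
    exact: orthogonal_nocorner_diag1l.
  by rewrite border_diag1l /col_dir/= scalemxAr.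
have mA' : measurable [set D | A (hG (diag1 g *m G) *m diag1 D)].
  by rewrite -[X in measurable X]setTI; exact: (measurable_fun_pair2 _ mGD).
rewrite -(haar_mul delta_haar oC (orthogonalmx1 R m) mA'); congr (delta _).
by apply/seteqP; split => D /=; rewrite mulmx1 mulmxA gE -mulmxA diag1M.
Qed.

Context (eta : probability 'M[R]_(1 + m) R).
Context (eta_orth : eta [set H | orthogonalmx H] = 1).
Context (eta_inv : forall g, orthogonalmx g -> forall A, measurable A ->
  eta [set H | A (g *m H)] = eta A).

Lemma measurable_mul_diag1 : measurable_fun setT
  (fun GH : 'M[R]_(1 + (1 + m)) * 'M[R]_(1 + m) => GH.1 *m diag1 GH.2).
Proof. by apply: measurable_mulmx => //; exact: measurable_block_mx. Qed.

(** Unlike an average over matrices that depend on Gamma, this one preserves the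
    law of Gamma: after Fubini, diag(1, H) is a fixed orthogonal matrix. *)
Lemma integral_average (F : 'M[R]_(1 + (1 + m)) -> \bar R) :
  measurable_fun setT F -> (forall G, 0 <= F G) ->
  \int[P]_t F (Gam t) = \int[P]_t \int[eta]_H F (Gam t *m diag1 H).
Proof.
move=> mF F0; pose f (tH : T * 'M[R]_(1 + m)) := F (Gam tH.1 *m diag1 tH.2).
have mf : measurable_fun setT f.
  apply: (measurableT_comp mF); apply: (measurableT_comp measurable_mul_diag1
    (g := fun tH : T * 'M[R]_(1 + m) => (Gam tH.1, tH.2))).
  by apply: measurable_fun_pair => //; exact: measurableT_comp.
have f0 tH : 0 <= f tH by exact: F0.
rewrite (@fubini_tonelli _ _ _ _ _ P eta f mf f0).
rewrite -[LHS]mule1 -(probability_setT eta) -integral_cst//.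
apply: (eq_integral_prob_on (@measurable_orthogonalmx R (1 + m)) eta_orth) => //.
- exact: measurable_fun_fubini_tonelli_G.
- by move=> H; apply: integral_ge0.
- by move=> H; apply: integral_ge0.
move=> H oH /=; apply/esym.
exact: (integral_haar_mulr (diag1_orthogonal oH) mF F0).
Qed.

(** The conditional probability of C given the border, were the theorem true. *)
Definition resample_prob (C : set 'M[R]_(1 + (1 + m))) G :=
  delta [set D | C (resample (border G) D)].

Lemma measurable_resample_prob C : measurable C ->
  measurable_fun setT (resample_prob C).
Proof.
move=> mC; apply: (measurable_prob_section delta
  (E := fun G D => C (resample (border G) D))).
rewrite -[X in measurable X]setTI.
apply: (measurableT_comp (@measurable_resample R m)
  (g := fun GD : 'M[R]_(1 + (1 + m)) * 'M[R]_m => (border GD.1, GD.2))) => //.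
by apply: measurable_fun_pair => //; exact: measurableT_comp.
Qed.

(** The two sides are compared through the orbit points N D, all of the form
    G diag(1, g): the left side does not see which of them H starts from, so it
    may be averaged over D; for H frozen, that average is over inner blocks
    K core(D) H, which are in frames adapted to the border of N D diag(1, H). *)
Lemma average_resample G C : orthogonal_nocorner G -> measurable C ->
  eta [set H | C (G *m diag1 H)] = \int[eta]_H resample_prob C (G *m diag1 H).
Proof.
move=> nG mC; set b := border G.
pose K := householder (col_dir b); pose L := householder (row_dir b).
have oK : orthogonalmx K by exact: householder_orthogonal.
have oL : orthogonalmx L by exact: householder_orthogonal.
have Ke : K *m eps1 R m = col_dir b by rewrite householder_eps1// sqnorm_col_dir.
have Le : L *m eps1 R m = row_dir b by rewrite householder_eps1// sqnorm_row_dir.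
pose s : R := Num.sqrt (1 - b.2 ^+ 2).
have s0 : s != 0%R by rewrite gt_eqF// sqrtr_gt0 corner_lt1.
pose N D := block_mx b.2%:M (s *: (eps1 R m)^T) b.1.1 (K *m core b.2 D).
have coset D (oD : orthogonalmx D) := orthogonal_nocorner_coset nG oK Ke oL Le oD.
have mE : measurable [set DH | C (N DH.1 *m diag1 DH.2)].
  rewrite -[X in measurable X]setTI.
  apply: (measurableT_comp measurable_mul_diag1
    (g := fun DH : 'M[R]_m * 'M[R]_(1 + m) => (N DH.1, DH.2))) => //.
  apply: measurable_fun_pair => //.
  apply: measurable_block_mx => //; apply: measurable_mulmx => //.
  by apply: measurable_block_mx.
have mGC : measurable [set H | C (G *m diag1 H)].
  rewrite -[X in measurable X]setTI.
  exact: (measurable_fun_pair2 G measurable_mul_diag1).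
have etaN D : orthogonalmx D ->
    eta [set H | C (N D *m diag1 H)] = eta [set H | C (G *m diag1 H)].
  move=> oD; have [g og gE] := coset D oD.
  rewrite -(eta_inv og mGC); congr (eta _).
  by apply/seteqP; split => H /=; rewrite /N -diag1M mulmxA gE.
transitivity (\int[delta]_D eta [set H | C (N D *m diag1 H)]).
  rewrite -[LHS]mule1 -(probability_setT delta) -integral_cst//.
  apply: (eq_integral_prob_on (@measurable_orthogonalmx R m) delta_haar.1) => //.
    exact: (measurable_prob_section eta (E := fun D H => C (N D *m diag1 H))).
  by move=> D oD /=; rewrite etaN.
rewrite (integral_prob_section _ _ mE).
(* The border of N D diag(1, H) does not involve D, so D = 1 can be used to
   recognize it as the border of some G diag(1, g H). *)
have [g og gE] := coset _ (orthogonalmx1 R m).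
transitivity (\int[eta]_H resample_prob C (G *m diag1 (g *m H))); last first.
  apply: (integral_invariant (f := fun H => g *m H)
    (F := fun H => resample_prob C (G *m diag1 H))) => //.
  - by apply: measurable_mulmx.
  - by move=> A mA; exact: eta_inv.
  - apply: (measurableT_comp (measurable_resample_prob mC)).
    exact: (measurable_fun_pair2 G measurable_mul_diag1).
apply: (eq_integral_prob_on (@measurable_orthogonalmx R (1 + m)) eta_orth) => //.
- apply: (measurable_prob_section delta (E := fun H D => C (N D *m diag1 H))).
  rewrite (_ : mkset _ = (fun HD => (HD.2, HD.1)) @^-1`
    [set DH | C (N DH.1 *m diag1 DH.2)])//.
  by rewrite -[X in measurable X]setTI; exact: measurable_swap.
- apply: (measurableT_comp (measurable_resample_prob mC)).
  apply: measurable_mulmx => //; apply: measurable_block_mx => //.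
  exact: measurable_mulmx.
move=> H oH; set G' := G *m diag1 (g *m H).
have nG' : orthogonal_nocorner G'.
  by apply: orthogonal_nocorner_diag1r => //; exact: orthogonalmxM.
have bG' : border G' = (b.1.1, s *: ((eps1 R m)^T *m H), b.2).
  by rewrite /G' -diag1M mulmxA gE block_diag1r border_blockE -scalemxAl.
have Ke' : K *m eps1 R m = col_dir (border G') by rewrite bG'.
have He' : H^T *m eps1 R m = row_dir (border G').
  rewrite bG' /row_dir /= [(_ *: _)^T]linearZ /= scalerA mulVf// scale1r.
  by rewrite trmx_mul trmxK.
have NE D : N D *m diag1 H = block_mx (border G').2%:M (border G').1.2
    (border G').1.1 (K *m core (border G').2 D *m H).
  by rewrite /N block_diag1r -scalemxAl bG'.
pose B := [set M | C (block_mx (border G').2%:M (border G').1.2 (border G').1.1 M)].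
have mB : measurable B.
  by rewrite -[X in measurable X]setTI; apply: measurable_block_mx.
have := inner_frame delta_haar nG' oK Ke' (orthogonalmxT oH) He' mB.
rewrite trmxK /resample_prob => <-; congr (delta _).
by apply/seteqP; split => D /=; rewrite NE.
Qed.

(** Both sides are averaged over H, where they agree for each value of Gamma. *)
Lemma resample_law C : measurable C ->
  P [set t | C (Gam t)] = \int[P]_t resample_prob C (Gam t).
Proof.
move=> mC; rewrite (probE_integral_indic P measurable_Gam mC).
rewrite (integral_average (F := fun G => (\1_C G)%:E)).
- rewrite (integral_average (measurable_resample_prob mC)) => //.
  apply: eq_integral => t _.
  rewrite -average_resample// (probE_integral_indic eta _ mC)//.
  exact: (measurable_fun_pair2 _ measurable_mul_diag1).
- by apply/measurable_EFinP; exact: measurable_indic.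
- by move=> G; rewrite lee_fin.
Qed.

End resampling.

(** * The conditional distribution of the inner block *)

Section inner_kernel.
Context (R : realType) (m : nat) (delta : probability 'M[R]_m R).
Local Notation bdr := ('cV[R]_(1 + m) * 'rV[R]_(1 + m) * R)%type.

Lemma measurable_inner_at (b : bdr) : measurable_fun setT (inner b).
Proof. exact: (measurable_fun_pair2 b (@measurable_inner R m)). Qed.

HB.instance Definition _ (b : bdr) :=
  @isMeasurableFun.Build _ _ _ _ (inner b) (measurable_inner_at b).

Definition inner_kernel (b : bdr) : {measure set 'M[R]_(1 + m) -> \bar R} :=
  distribution delta (inner b).

Lemma measurable_inner_kernel B : measurable B ->
  measurable_fun setT (inner_kernel ^~ B).
Proof.
move=> mB; apply: (measurable_prob_section delta (E := fun b D => B (inner b D))).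
by rewrite -[X in measurable X]setTI; exact: measurable_inner.
Qed.

HB.instance Definition _ :=
  isKernel.Build _ _ _ _ _ inner_kernel measurable_inner_kernel.

Lemma inner_kernel_setT b : inner_kernel b setT = 1%E.
Proof. exact: probability_setT. Qed.

HB.instance Definition _ :=
  Kernel_isProbability.Build _ _ _ _ _ inner_kernel inner_kernel_setT.

End inner_kernel.

Theorem theorem1p2 (R : realType) (m : nat) (hp : (3 <= 1 + (1 + m))%N)
  (d d' : measure_display) (T : measurableType d) (T' : measurableType d')
  (P : probability T R) (Q : probability T' R)
  (Gam : {RV P >-> 'M[R]_(1 + (1 + m))})
  (Gam_haar : is_haar (distribution P Gam))
  (Gam_sample : forall t, orthogonal_nocorner (Gam t))
  (h1 h2 : 'cV[R]_(1 + m) -> 'rV[R]_(1 + m) -> R -> 'M[R]_(1 + m))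
  (h1P : forall u v a, border_values (u, v, a) ->
     orthogonalmx (h1 u v a) /\
     h1 u v a *m eps1 R m = (Num.sqrt (1 - a ^+ 2))^-1 *: u)
  (h2P : forall u v a, border_values (u, v, a) ->
     orthogonalmx (h2 u v a) /\
     h2 u v a *m eps1 R m = (Num.sqrt (1 - a ^+ 2))^-1 *: v^T)
  (Del : {RV Q >-> 'M[R]_m})
  (Del_haar : is_haar (distribution Q Del)) :
  exists k : R.-pker ('cV[R]_(1 + m) * 'rV[R]_(1 + m) * R)%type ~>
               'M[R]_(1 + m),
    is_cond_distribution (P := P) (drsubmx \o Gam) (@border R m \o Gam) k /\
    forall u v a, border_values (u, v, a) ->
      forall B, measurable B ->
        k (u, v, a) B =
        pushforward Q
          (fun w => h1 u v a *m block_mx (- a)%:M 0 0 (Del w) *m (h2 u v a)^T)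
          B.
Proof.
have [eta [eta_orth eta_inv]] := exists_left_haar Gam_haar Gam_sample Del_haar.
exists (inner_kernel (distribution Q Del)); split => [A B mA mB|u v a uva B mB].
- pose C := @border R m @^-1` A `&` drsubmx @^-1` B.
  have mC : measurable C.
    apply: measurableI; rewrite -[X in measurable X]setTI.
      exact: (@measurable_border R m).
    exact: measurable_drsubmx.
  transitivity (P [set t | C (Gam t)]); first by [].
  rewrite (resample_law Gam_haar Gam_sample Del_haar eta_orth eta_inv mC).
  rewrite [RHS]integral_mkcond.
  have mk : measurable_fun setT
      ((fun b => inner_kernel (distribution Q Del) b B) \_ A).
    apply/(measurable_restrictT _ mA); apply: measurable_funTS.
    exact: measurable_inner_kernel.
  rewrite ge0_integral_pushforward//; last by move=> b _; exact: erestrict_ge0.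
  rewrite preimage_setT; apply: eq_integral => t _ /=; rewrite /resample_prob patchE.
  set b := border (Gam t); have CE D : C (resample b D) = (A b /\ B (inner b D)).
    by rewrite /C /= /resample border_blockE block_mxKdr -!surjective_pairing.
  have -> : [set D | C (resample b D)] = [set D | A b /\ B (inner b D)].
    by apply/funext => D; exact: CE.
  case: ifPn => [|/negP]; rewrite inE => bA.
    by congr (distribution Q Del _); apply/seteqP; split => D //= [].
  by rewrite -[RHS](measure0 (distribution Q Del)); congr (distribution Q Del _);
    apply/seteqP; split => D //= [].
have [h1o h1e] := h1P _ _ _ uva; have [h2o h2e] := h2P _ _ _ uva.
case: uva => G nG GE.
transitivity (distribution Q Del [set D | B (inner (u, v, a) D)]); first by [].
have := @inner_frame R m (distribution Q Del) G (h1 u v a) (h2 u v a) B Del_haar nG.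
by rewrite GE => /(_ h1o h1e h2o h2e mB) <-.
Qed.
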